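(* For integers $b\geq 0$ the following hold: $n(1,b,5)=b+2$ for even $b\geq 2$; $n(1,b,5)=b+3$ for odd $b\geq 3$; $n(2,b,5)=b+5$; $n(1,b,6)=2b+2$ for $b\geq 1$; $n(2,b,6)=2b+6$.
   Context: A weighted graph (wgraph) is a pair $G=(L,H)$ of simple finite graphs with $V(L)=V(H)$ and $E(L)\cap E(H)=\varnothing$; edges of $L$ are light (weight 1) and edges of $H$ are heavy (weight 2). A wcycle is a cycle (of length at least 3) in the graph with edge set $E(L)\cup E(H)$; its weight is the sum of the weights of its edges. The girth of $G$ is the minimum weight of a wcycle. $G$ is $(a,b)$-regular if $L$ is $a$-regular and $H$ is $b$-regular. An $(a,b,g)$-wgraph is an $(a,b)$-regular wgraph of girth $g$. $n(a,b,g)$ denotes the minimum order of an $(a,b,g)$-wgraph ($\infty$ if none exists). *)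

(* Defs.v *)
From mathcomp Require Import all_boot.
From mathcomp Require Import boolp.

Set Implicit Arguments.
Unset Strict Implicit.
Unset Printing Implicit Defensive.

Record sgraph (T : finType) := SGraph {
  adj :> rel T;
  adj_sym : symmetric adj;
  adj_irr : irreflexive adj
}.

Definition regular (T : finType) (k : nat) (G : sgraph T) : Prop :=
  forall x : T, #|[set y | G x y]| = k.

Record wgraph (T : finType) := WGraph {
  light : sgraph T;
  heavy : sgraph T;
  light_heavy_disjoint : forall x y : T, ~~ (light x y && heavy x y)
}.

Section WGraph.
Variables (T : finType) (G : wgraph T).

Definition wedge : rel T := fun x y => light G x y || heavy G x y.

(* A cycle is given by the list of its vertices, pairwise distinct, in cyclic
   order. *)
Definition wcycle (c : seq T) : Prop := 3 <= size c /\ ucycle wedge c.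

(* Light edges weigh 1 and heavy edges 2; non-edges get weight 0. *)
Definition edge_weight (x y : T) : nat := light G x y + 2 * heavy G x y.

Definition weight (c : seq T) : nat := \sum_(x <- c) edge_weight x (next c x).

End WGraph.

(* The minimum of a set of natural numbers; None stands for infinity, the
   minimum of the empty set. *)
Definition min_nat (P : nat -> Prop) : option nat :=
  if pselect (exists n, `[< P n >]) is left exP then Some (ex_minn exP)
  else None.

Lemma min_natP (P : nat -> Prop) (m : nat) :
  min_nat P = Some m <-> P m /\ forall k, P k -> m <= k.
Proof.
rewrite /min_nat; case: pselect => [exP|nexP]; last first.
  by split=> // -[Pm _]; case: nexP; exists m; apply/asboolP.
case: ex_minnP => n /asboolP Pn minn; split=> [[<-]|[Pm minm]].
  by split=> // k Pk; apply: minn; apply/asboolP.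
by congr Some; apply/eqP; rewrite eqn_leq minm // minn //; apply/asboolP.
Qed.

Lemma min_nat_None (P : nat -> Prop) :
  min_nat P = None <-> forall k, ~ P k.
Proof.
split=> [minP k Pk|noP].
  move: minP; rewrite /min_nat; case: pselect => // -[]; exists k.
  exact/asboolP.
by case minP: (min_nat P) => [m|//]; case/min_natP: minP => /noP.
Qed.

Definition girth (T : finType) (G : wgraph T) : option nat :=
  min_nat (fun w => exists2 c : seq T, wcycle G c & weight G c = w).

Definition is_wgraph (a b g : nat) (T : finType) (G : wgraph T) : Prop :=
  [/\ regular a (light G), regular b (heavy G) & girth G = Some g].

Definition min_order (a b g : nat) : option nat :=
  min_nat (fun m => exists (T : finType) (G : wgraph T),
    is_wgraph a b g G /\ #|T| = m).

(* Main.v *)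
(* A cycle weighs at least its length, so girth at least 5 or 6 only constrains
   cycles on 3, 4 or 5 vertices.

   Lower bounds: in girth 5 with a = 2, a light path x y z t u consists of
   distinct vertices and none of them is a heavy neighbour of its middle vertex
   z.  In girth 6 the two ends of a light edge have no common heavy neighbour;
   if a = 2 these heavy neighbourhoods also avoid the six distinct vertices of
   the light path having that edge in the middle.  For a = 1 the light graph is
   a perfect matching, so the order is even.

   Optimal wgraphs:
   - a = 1, girth 5: a complete graph with a light perfect matching, from which
     a second perfect matching is removed when b is odd;
   - a = 1, girth 6: K_(b+1,b+1) with a light perfect matching;
   - a = 2, girth 5: a light cycle of length b + 5, with heavy edges between the
     vertices at light distance at least 3;
   - a = 2, girth 6: a light cycle of length 2b + 6, with heavy edges between
     the vertices at even light distance at least 4. *)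
Require Import Defs.
From mathcomp Require Import all_boot all_algebra zify ring.

Set Implicit Arguments.
Unset Strict Implicit.
Unset Printing Implicit Defensive.

(** * Weights of cycles and criteria for girth 5 and 6 *)

Section Girth.
Variables (T : finType) (G : wgraph T).
Implicit Types (x y z t u : T) (c : seq T).

Local Notation L := (light G).
Local Notation H := (heavy G).

(** Walking along the list closed up by its first vertex replaces [next], so the weight of an
    explicit cycle simplifies. Uniqueness lets [index] recover the position of each vertex. *)
Lemma weight_pairmap x c :
  uniq (x :: c) ->
  weight G (x :: c) = sumn (pairmap (edge_weight G) x (rcons c x)).
Proof.
move=> Uc; rewrite /weight sumnE (big_nth x) [RHS](big_nth 0).
rewrite size_pairmap size_rcons !big_mkord; apply: eq_bigr => i _.
rewrite (nth_pairmap x) ?size_rcons // next_nth mem_nth // index_uniq //.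
rewrite -rcons_cons !nth_rcons /= ltn_ord; congr edge_weight.
(* At the last vertex, [next] wraps around through the default value [x] of [nth], which agrees with
   the final [x] of [rcons c x]. *)
case: ltnP => // le_c_i; rewrite nth_default // eqn_leq le_c_i.
by rewrite -ltnS ltn_ord.
Qed.

Lemma edge_weight_light x y : L x y -> edge_weight G x y = 1.
Proof.
move=> Lxy; have := light_heavy_disjoint G x y.
by rewrite /edge_weight Lxy; case: (H x y).
Qed.

Lemma edge_weight_heavy x y : H x y -> edge_weight G x y = 2.
Proof.
move=> Hxy; have := light_heavy_disjoint G x y.
by rewrite /edge_weight Hxy; case: (L x y).
Qed.

Lemma edge_weight_wedge x y : wedge G x y -> edge_weight G x y = 2 - L x y.
Proof.
case/orP=> e; first by rewrite edge_weight_light ?e.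
by have := edge_weight_heavy e; rewrite /edge_weight e; case: (L x y).
Qed.

Lemma wedge_sym x y : wedge G x y = wedge G y x.
Proof. by rewrite /wedge adj_sym [H x y]adj_sym. Qed.

Lemma wedge_irr x : wedge G x x = false.
Proof. by rewrite /wedge !adj_irr. Qed.

Lemma wedge_neq x y : wedge G x y -> x != y.
Proof. by apply: contraTneq => ->; rewrite wedge_irr. Qed.

Lemma light_wedge x y : L x y -> wedge G x y.
Proof. by move=> e; apply/orP; left. Qed.

Lemma heavy_wedge x y : H x y -> wedge G x y.
Proof. by move=> e; apply/orP; right. Qed.

Lemma light_neq x y : L x y -> x != y.
Proof. by move/light_wedge/wedge_neq. Qed.

Lemma girth_eq g :
  (exists2 c, wcycle G c & weight G c = g) ->
  (forall c, wcycle G c -> g <= weight G c) -> girth G = Some g.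
Proof. by move=> exc minc; apply/min_natP; split=> // _ [c /minc ? <-]. Qed.

Lemma size_le_weight c : wcycle G c -> size c <= weight G c.
Proof.
case: c => [|x c] [_ /andP[/= cyc Uc]] //; rewrite weight_pairmap //.
rewrite [size _]/= -(size_rcons c x).
move: (rcons c x) cyc => s {Uc}; elim: s x => //= z s IHs y.
case/andP=> /edge_weight_wedge-> /IHs; case: (L y z) => /=; lia.
Qed.

(** A cycle of weight at most 4 is a triangle with at least two light edges or a light 4-cycle. *)
Lemma girth_eq5 :
  (exists2 c, wcycle G c & weight G c = 5) ->
  (forall x y z, L x y -> L y z -> ~~ wedge G z x) ->
  (forall x y z t, L x y -> L y z -> L z t -> L t x -> (x == z) || (y == t)) ->
  girth G = Some 5.
Proof.
move=> exc no3 no4; apply: girth_eq => // c wc.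
have nLL x y z : wedge G z x -> L x y && L y z = false.
  by move=> wzx; apply/negP => /andP[Lxy /(no3 _ _ _ Lxy)]; rewrite wzx.
have := size_le_weight wc; case: (wc) => + /andP[+ Uc].
case: c Uc {wc} => [|x [|y [|z [|t [|u c]]]]] // Uc _ cyc;
  rewrite ?weight_pairmap //=; last by rewrite /= in Uc *; lia.
- case/and4P: cyc => wxy wyz wzx _ _; rewrite !edge_weight_wedge //.
  have := nLL _ y _ wzx; have := nLL _ z _ wxy; have := nLL _ x _ wyz.
  by case: (L x y) (L y z) (L z x) => [] [] [].
- case/and5P: cyc => wxy wyz wzt wtx _ _; rewrite !edge_weight_wedge //.
  have := no4 x y z t; move: Uc; rewrite /= !inE !negb_or.
  case/and4P=> /and3P[_ /negPf-> _] /andP[_ /negPf->] _ _.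
  case: (L x y) (L y z) (L z t) (L t x) => [] [] [] [] //.
  by move=> /(_ isT isT isT isT).
Qed.
(** A cycle of weight at most 5 is a triangle with a light edge, a 4-cycle with at least three light
    edges, or a light 5-cycle. *)
Lemma girth_eq6 :
  (exists2 c, wcycle G c & weight G c = 6) ->
  (forall x y z, L x y -> wedge G y z -> ~~ wedge G z x) ->
  (forall x y z t, L x y -> L y z -> L z t -> wedge G t x ->
    (x == z) || (y == t)) ->
  (forall x y z t u, L x y -> L y z -> L z t -> L t u -> ~~ L u x) ->
  girth G = Some 6.
Proof.
move=> exc no3 no4 no5; apply: girth_eq => // c wc.
have nL x y z : wedge G y z -> wedge G z x -> L x y = false.
  by move=> wyz wzx; apply/negP => /no3/(_ wyz); rewrite wzx.
have nLLL x y z t : x != z -> y != t -> wedge G t x ->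
    [&& L x y, L y z & L z t] = false.
  move=> /negPf nxz /negPf nyt wtx; apply/negP => /and3P[Lxy Lyz Lzt].
  by have := no4 _ _ _ _ Lxy Lyz Lzt wtx; rewrite nxz nyt.
have := size_le_weight wc; case: (wc) => + /andP[+ Uc].
case: c Uc {wc} => [|x [|y [|z [|t [|u [|v c]]]]]] // Uc _ cyc;
  rewrite ?weight_pairmap //=; last by rewrite /= in Uc *; lia.
- case/and4P: cyc => wxy wyz wzx _ _; rewrite !edge_weight_wedge //.
  by rewrite (nL x y z) // (nL y z x) // (nL z x y).
- case/and5P: cyc => wxy wyz wzt wtx _ _; rewrite !edge_weight_wedge //.
  move: Uc; rewrite /= !inE !negb_or => /and4P[/and3P[_ nxz _] /andP[_ nyt] _
    _].
  (* All four rotations are used, since the edge that may be heavy can be any of the four. *)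
  have := nLLL _ _ _ _ nxz nyt wtx; have := nLLL y z t x nyt.
  have := nLLL z t x y; have := nLLL t x y z;
    rewrite ![_ == x]eq_sym ![_ == y]eq_sym.
  rewrite nxz nyt => /(_ isT isT wzt) + /(_ isT isT wyz) + /(_ isT wxy).
  by case: (L x y) (L y z) (L z t) (L t x) => [] [] [] [].
- case/and5P: cyc => wxy wyz wzt wtu /andP[wux _] _.
  rewrite !edge_weight_wedge //; have := no5 x y z t u.
  case: (L x y) (L y z) (L z t) (L t u) (L u x) => [] [] [] [] [] //.
  by move=> /(_ isT isT isT isT).
Qed.

(** * Short cycles excluded by the girth *)

Section ShortCycles.
Variable g : nat.
Hypothesis girthG : girth G = Some g.

(** Finite girth provides a cycle, hence a vertex from which the lower bounds can start. *)
Lemma girth_wcycle : exists c, wcycle G c.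
Proof. by case/min_natP: girthG => -[c wc _] _; exists c. Qed.

Lemma girth_le_weight x c :
  2 < (size c).+1 -> uniq (x :: c) -> path (wedge G) x (rcons c x) ->
  g <= sumn (pairmap (edge_weight G) x (rcons c x)).
Proof.
move=> sz_c Uc cyc; rewrite -weight_pairmap //; case/min_natP: girthG => _.
by apply; exists (x :: c); last by []; split=> //; rewrite /ucycle Uc andbT.
Qed.

(** Such a triangle would weigh at most 1 + 1 + 2 = 4. *)
Lemma no_lightlight_triangle x y z :
  5 <= g -> L x y -> L y z -> x != z -> ~~ wedge G x z.
Proof.
move=> g5 Lxy Lyz nxz; apply/negP; rewrite wedge_sym => wzx.
have := @girth_le_weight x [:: y; z] isT; rewrite /= !inE negb_or nxz.
rewrite !light_neq //= wzx !light_wedge //= => /(_ isT isT).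
rewrite (edge_weight_light Lxy) (edge_weight_light Lyz).
by rewrite (edge_weight_wedge wzx); case: (L z x); lia.
Qed.

Lemma no_light_square x y z t :
  5 <= g -> L x y -> L y z -> L z t -> x != z -> y != t -> ~~ L t x.
Proof.
move=> g5 Lxy Lyz Lzt nxz nyt; apply/negP => Ltx.
have := @girth_le_weight x [:: y; z; t] isT; rewrite /= !inE !negb_or nxz nyt.
rewrite (eq_sym x t) !light_neq //= !light_wedge //= => /(_ isT isT).
by rewrite !edge_weight_light //; lia.
Qed.

Lemma no_light_triangle6 x y z :
  6 <= g -> L x y -> wedge G y z -> ~~ wedge G z x.
Proof.
move=> g6 Lxy wyz; apply/negP => wzx.
have := @girth_le_weight x [:: y; z] isT; rewrite /= !inE negb_or.
rewrite (eq_sym x z) (light_neq Lxy) !wedge_neq //= wzx wyz light_wedge //=.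
move=> /(_ isT isT); rewrite edge_weight_light // !edge_weight_wedge //.
by case: (L y z) (L z x) => [] []; lia.
Qed.

(** Such a 4-cycle would weigh at most 3 + 2 = 5. *)
Lemma no_light3_square6 x y z t :
  6 <= g -> L x y -> L y z -> L z t -> x != z -> y != t -> ~~ wedge G t x.
Proof.
move=> g6 Lxy Lyz Lzt nxz nyt; apply/negP => wtx.
have := @girth_le_weight x [:: y; z; t] isT; rewrite /= !inE !negb_or nxz nyt.
rewrite (eq_sym x t) (wedge_neq wtx) !light_neq //= wtx !light_wedge //=.
move=> /(_ isT isT); rewrite (edge_weight_light Lxy) (edge_weight_light Lyz).
by rewrite (edge_weight_light Lzt) (edge_weight_wedge wtx); case: (L t x); lia.
Qed.

Lemma no_light_pentagon6 x y z t u :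
  6 <= g -> L x y -> L y z -> L z t -> L t u ->
  uniq [:: x; y; z; t; u] -> ~~ L u x.
Proof.
move=> g6 Lxy Lyz Lzt Ltu Uc; apply/negP => Lux.
have := girth_le_weight _ Uc; rewrite /= !light_wedge //= => /(_ isT isT).
by rewrite !edge_weight_light //; lia.
Qed.

End ShortCycles.
End Girth.

(** The counting step of the lower bounds: [s] lists explicit vertices and [A] is a set of heavy
    neighbours avoiding them. *)
Lemma leq_size_card (T : finType) (s : seq T) (A : {set T}) :
  uniq s -> {in A, forall y, y \notin s} -> size s + #|A| <= #|T|.
Proof.
move=> Us sA; rewrite cardE -size_cat; set c := s ++ _.
suff /card_uniqP <-: uniq c by apply: max_card.
rewrite cat_uniq Us enum_uniq andbT; apply/hasPn => y /=.
by rewrite mem_enum => /sA.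
Qed.

(** * Lower bounds on the order *)

Section LowerBounds.
Variables (T : finType) (G : wgraph T) (b g : nat).

Local Notation L := (light G).
Local Notation H := (heavy G).

Lemma light_nbr_other a x y :
  regular a L -> 2 <= a -> L x y -> exists2 z, L y z & x != z.
Proof.
move=> /(_ y) + a2; rewrite (cardsD1 x) => def_a Lxy.
have /card_gt0P[z]: 0 < #|[set z | L y z] :\ x|.
  by move: a2; rewrite -def_a; case: (x \in _) => //=; lia.
by rewrite !inE eq_sym => /andP[nxz Lyz]; exists z.
Qed.

Lemma light_edge a : is_wgraph a b g G -> 0 < a -> exists x y, L x y.
Proof.
case=> regL _ /girth_wcycle[[|x c] [//= _ _]] a0; exists x.
have /card_gt0P[y]: 0 < #|[set y | L x y]| by rewrite regL.
by rewrite inE; exists y.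
Qed.

(** A coincidence [y = u] or [x = t] would close a light triangle, and [x = u] a light 4-cycle. *)
Lemma uniq_light_path5 x y z t u :
  girth G = Some g -> 5 <= g -> L x y -> L y z -> L z t -> L t u ->
  x != z -> y != t -> z != u -> uniq [:: x; y; z; t; u].
Proof.
move=> gG g5 Lxy Lyz Lzt Ltu nxz nyt nzu.
have nyu : y != u.
  apply: contraTneq (light_wedge Lyz) => ->; rewrite wedge_sym.
  by apply: (no_lightlight_triangle gG g5 Lzt Ltu nzu).
have nxt : x != t.
  apply: contraTneq (light_wedge Lxy) => ->; rewrite wedge_sym.
  by apply: (no_lightlight_triangle gG g5 Lyz Lzt nyt).
have nxu : x != u.
  by apply: contraTneq Ltu => <-;
    apply: (no_light_square gG g5 Lxy Lyz Lzt nxz nyt).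
rewrite /= !inE !negb_or nxz nyt nzu nyu nxt nxu.
by rewrite (light_neq Lxy) (light_neq Lyz) (light_neq Lzt) (light_neq Ltu).
Qed.

Lemma heavy_light_neq x y z : L x y -> H x z -> z != y.
Proof.
move=> Lxy; apply: contraTneq => ->.
by have := light_heavy_disjoint G x y; rewrite Lxy.
Qed.

Lemma heavy_neq x y : H x y -> y != x.
Proof. by move/heavy_wedge/wedge_neq; rewrite eq_sym. Qed.

Lemma order_ge_degree a : is_wgraph a b g G -> 0 < a -> b + 2 <= #|T|.
Proof.
move=> wG a0; have [x [y Lxy]] := light_edge wG a0; case: wG => _ regH _.
rewrite addnC -(regH x); apply: (@leq_size_card _ [:: x; y]).
  by rewrite /= inE (light_neq Lxy).
move=> z; rewrite !inE => Hxz.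
by rewrite negb_or (heavy_neq Hxz) (heavy_light_neq Lxy).
Qed.

(** Sending each vertex to its light neighbour is an involution without fixed points. *)
Lemma order_even : regular 1 L -> ~~ odd #|T|.
Proof.
move=> regL; pose f x := odflt x [pick y | L x y].
have Lf x y : L x y = (y == f x).
  have /eqP/cards1P[z /setP eqz] := regL x.
  have Lz t : L x t = (t == z) by have := eqz t; rewrite !inE.
  by rewrite Lz /f; case: pickP => [t|/(_ z)]; rewrite Lz ?eqxx // => /eqP->.
have fK : involutive f.
  by move=> x; apply/eqP; rewrite eq_sym -Lf adj_sym Lf.
have fN x : f x != x by rewrite eq_sym (@light_neq _ G) ?Lf.
have ord2 : T \subset order_set f 2.
  apply/subsetP => x _; rewrite inE (@order_cycle _ f [:: x; f x]) //=.
  - by rewrite fK !eqxx.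
  - by rewrite inE eq_sym fN.
  - by rewrite mem_head.
(* All orbits of [f] have size 2, so the order is twice their number. *)
by have <- := fcard_order_set (inv_inj fK) ord2 (fun _ _ _ => erefl);
  rewrite muln2 odd_double.
Qed.

(** A light edge [z t] is extended without backtracking, once beyond [t] and twice beyond [z]. *)
Lemma light_path5 : is_wgraph 2 b g G -> 5 <= g ->
  exists x y z t u, [/\ uniq [:: x; y; z; t; u],
    [/\ L x y, L y z, L z t & L t u], x != z & z != u].
Proof.
move=> wG g5; have [z [t Lzt]] := light_edge wG isT; case: wG => regL _ gG.
have [u Ltu nzu] := light_nbr_other regL isT Lzt.
have [y Lzy nty] := light_nbr_other regL isT (etrans (adj_sym L t z) Lzt).
have [x Lyx nzx] := light_nbr_other regL isT Lzy.
exists x, y, z, t, u; rewrite eq_sym in nty; rewrite eq_sym in nzx.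
rewrite adj_sym in Lzy; rewrite adj_sym in Lyx.
by split=> //; apply: (uniq_light_path5 gG g5 _ _ _ _ _ _ _).
Qed.

(** A heavy edge from [z] to [x] or [u] would close a triangle with two light edges, while [y] and
    [t] are already light neighbours of [z]. *)
Lemma order_ge_2_5 : is_wgraph 2 b g G -> 5 <= g -> b + 5 <= #|T|.
Proof.
move=> wG g5; have [x [y [z [t [u [Us [Lxy Lyz Lzt Ltu] nxz nzu]]]]]] :=
  light_path5 wG g5.
case: wG => _ regH gG; rewrite addnC -(regH z).
apply: (leq_size_card Us) => v; rewrite inE => Hzv.
have no := no_lightlight_triangle gG g5; have wzv := heavy_wedge Hzv.
rewrite !inE !negb_or (heavy_neq Hzv) (heavy_light_neq Lzt) //.
rewrite (@heavy_light_neq z y) // 1?adj_sym //.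
have -> : v != x.
  by apply: contraTneq wzv => ->; rewrite wedge_sym (no _ y).
by apply: contraTneq wzv => ->; rewrite (no _ t).
Qed.

(** A common heavy neighbour would form a triangle of weight 5 with the light edge, so the two
    neighbourhoods are disjoint. *)
Lemma heavy_nbrs_light_edge x y : girth G = Some g -> 6 <= g ->
  regular b H -> L x y ->
  #|[set z | H x z] :|: [set z | H y z]| = 2 * b.
Proof.
move=> gG g6 regH Lxy; rewrite cardsU !regH mul2n -addnn.
suff -> : [set z | H x z] :&: [set z | H y z] = set0 by rewrite cards0 subn0.
apply/setP => z; rewrite !inE; apply/negP => /andP[Hxz Hyz].
have := no_light_triangle6 gG g6 Lxy (heavy_wedge Hyz).
by rewrite wedge_sym heavy_wedge.
Qed.

Lemma order_ge_1_6 a : is_wgraph a b g G -> 0 < a -> 6 <= g ->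
  2 * b + 2 <= #|T|.
Proof.
move=> wG a0 g6; have [x [y Lxy]] := light_edge wG a0.
case: wG => _ regH gG; rewrite addnC -(heavy_nbrs_light_edge gG g6 regH Lxy).
apply: (@leq_size_card _ [:: x; y]); first by rewrite /= inE (light_neq Lxy).
have Lyx : L y x by rewrite adj_sym.
move=> z; rewrite !inE negb_or => /orP[Hxz|Hyz].
  by rewrite (heavy_neq Hxz) (heavy_light_neq Lxy).
by rewrite (heavy_neq Hyz) (heavy_light_neq Lyx).
Qed.

(** If [w] were [x] or [u], a triangle with two light edges would arise; if [w] were [v], a 4-cycle
    [z t u v] of weight 5. *)
Lemma heavy_nbr_path6 x y z t u v w : girth G = Some g -> 6 <= g ->
  L x y -> L y z -> L z t -> L t u -> L u v ->
  x != z -> y != t -> z != u -> t != v -> H z w ->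
  w \notin [:: x; y; z; t; u; v].
Proof.
move=> gG g6 Lxy Lyz Lzt Ltu Luv nxz nyt nzu ntv Hzw.
have g5 := ltnW g6; have wzw := heavy_wedge Hzw.
have Lzy : L z y by rewrite adj_sym.
rewrite !inE !negb_or (heavy_neq Hzw) (heavy_light_neq Lzy) //.
rewrite (heavy_light_neq Lzt) //=; apply/and3P; split.
- apply: contraTneq wzw => ->; rewrite wedge_sym.
  by apply: (no_lightlight_triangle gG g5 Lxy).
- by apply: contraTneq wzw => ->; apply: (no_lightlight_triangle gG g5 Lzt).
- apply: contraTneq wzw => ->; rewrite wedge_sym.
  by apply: (no_light3_square6 gG g6 Lzt Ltu).
Qed.

Lemma order_ge_2_6 : is_wgraph 2 b g G -> 6 <= g -> 2 * b + 6 <= #|T|.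
Proof.
move=> wG g6; have g5 := ltnW g6.
have [x [y [z [t [u [Us [Lxy Lyz Lzt Ltu] nxz nzu]]]]]] := light_path5 wG g5.
case: wG => regL regH gG; have [v Luv ntv] := light_nbr_other regL isT Ltu.
have nyt : y != t by move: Us; rewrite /= !inE !negb_or => /and3P[_ /and3P[]].
have Us' := uniq_light_path5 gG g5 Lyz Lzt Ltu Luv nyt nzu ntv.
(* Otherwise the light path [x y z t u] would close to a light 5-cycle. *)
have nxv : x != v.
  by apply: contraTneq Luv => <-; apply: (no_light_pentagon6 gG g6 _ _ _ _ Us).
have Uxv : uniq [:: x; y; z; t; u; v].
  rewrite cons_uniq Us' andbT !inE !negb_or nxv andbT.
  by move: Us; rewrite cons_uniq !inE !negb_or => /andP[].
rewrite addnC -(heavy_nbrs_light_edge gG g6 regH Lzt).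
apply: (leq_size_card Uxv) => w; rewrite in_setU !in_set => /orP[] Hw.
  by apply: (heavy_nbr_path6 gG g6) Hw.
(* Read backwards, the path has [t] as its third vertex. *)
have -> : [:: x; y; z; t; u; v] = rev [:: v; u; t; z; y; x] by [].
rewrite mem_rev; apply: (heavy_nbr_path6 gG g6) Hw; rewrite 1?adj_sym //;
  by rewrite eq_sym.
Qed.
End LowerBounds.

(** * Girth 5 from a light perfect matching *)

Section Matching.
(* [e x] lists [x], its light neighbour [f x] and its non-neighbours. *)
Variables (T : finType) (f : T -> T) (e : T -> seq T) (k : nat).
Hypotheses (fK : involutive f) (f_neq : forall x, f x != x).
Hypotheses (e_sym : forall x y, (y \in e x) = (x \in e y)).
Hypotheses (e_id : forall x, x \in e x) (e_f : forall x, f x \in e x).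
Hypotheses (e_uniq : forall x, uniq (e x)) (size_e : forall x, size (e x) = k).

(** Heavy edges are the pairs outside [e]. The vertex [y] is heavily joined to both ends of the
    light edge [x], [f x], giving a triangle of weight 1 + 2 + 2. Nothing is lighter, since two
    consecutive light steps return to their start. *)
Lemma matching_wgraph5 x y : y \notin e x -> y \notin e (f x) ->
  exists G : wgraph T, is_wgraph 1 (#|T| - k) 5 G.
Proof.
move=> yNx yNfx; pose l := [rel x y | y == f x].
pose h := [rel x y | y \notin e x].
have l_sym : symmetric l.
  by move=> u v; rewrite /= -{1}(fK v) (inj_eq (inv_inj fK)) eq_sym.
have l_irr : irreflexive l by move=> u; rewrite /= eq_sym (negPf (f_neq u)).
have h_sym : symmetric h by move=> u v; rewrite /= e_sym.
have h_irr : irreflexive h by move=> u; rewrite /= e_id.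
have lh u v : ~~ (l u v && h u v).
  by apply/negP => /= /andP[/eqP->]; rewrite e_f.
exists (WGraph (light := SGraph l_sym l_irr) (heavy := SGraph h_sym h_irr) lh).
have neqx : x != y by apply: contraNneq yNx => <-.
have neqfx : f x != y by apply: contraNneq yNfx => <-.
split=> [u|u|].
- by rewrite -(cards1 (f u)); apply: eq_card => v; rewrite !inE.
- rewrite -(size_e u) -(card_uniqP (e_uniq u)) -(cardC (mem (e u))) addKn.
  by apply: eq_card => v; rewrite !inE.
- apply: girth_eq5 => [|u v w /eqP-> /eqP->|u v w t /eqP-> /eqP->].
  + exists [:: x; f x; y].
      split=> //; rewrite /ucycle /= !inE /wedge /= /l /h /= !negb_or eqxx
        neqx neqfx.
      by rewrite yNfx (e_sym y) yNx !orbT [x == _]eq_sym f_neq.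
    rewrite weight_pairmap /= ?inE ?negb_or ?neqx ?neqfx ?[x == _]eq_sym
      ?f_neq //.
    by rewrite edge_weight_light /= /l /= ?eqxx // !edge_weight_heavy //= /h
      /= ?(e_sym y).
  + by rewrite fK wedge_irr.
  + by rewrite fK eqxx.
Qed.
End Matching.

Lemma natr_ord_neq0 n k : 0 < k < n.+2 -> (k%:R : 'I_n.+2)%R != 0%R.
Proof.
by case/andP=> k0 kn; rewrite Zp_nat -val_eqE /= modn_small // -lt0n.
Qed.

(** * Constructions attaining the bounds *)

Section Existence.
Local Open Scope ring_scope.
Import GRing.Theory.

Lemma exists_1_5_even k :
  exists (T : finType) (G : wgraph T),
    is_wgraph 1 k.*2.+2 5 G /\ #|T| = k.*2.+4.
Proof.
pose T : finType := ('I_k.+2 * bool)%type.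
pose f (x : T) : T := (x.1, ~~ x.2).
have cardT : #|T| = k.*2.+4.
  by rewrite card_prod card_ord card_bool muln2 doubleS.
have [||x y|x|x|x|//|||G wG] :=
  @matching_wgraph5 T f (fun x => [:: x; f x]) 2 _ _ _ _ _ _ _
    (0, false) (1, false).
- by case=> i c; rewrite /f /= negbK.
- by case=> i []; rewrite /f xpair_eqE andbF.
- by rewrite !inE /f; case: x y => [i c] [j d];
    rewrite /= !xpair_eqE !(eq_sym j); case: c d => [] [].
- by rewrite mem_head.
- by rewrite !inE eqxx orbT.
- by rewrite /= inE andbT; case: x => i c; rewrite /f xpair_eqE eqxx /=;
    case: c.
- by [].
- by [].
by exists T, G; rewrite -{1}[k.*2.+2](addnK 2) addn2 -cardT.
Qed.

Lemma exists_1_5_odd k :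
  exists (T : finType) (G : wgraph T),
    is_wgraph 1 k.*2.+3 5 G /\ #|T| = k.*2.+4.+2.
Proof.
pose T : finType := ('I_k.+3 * bool)%type.
pose f (x : T) : T := (x.1, ~~ x.2).
(* The sign depends on the side so that [g] is an involution; the edges of [f] and [g] alternate
   around a single cycle through all vertices. *)
pose s c : 'I_k.+3 := if c then 1 else -1.
pose g (x : T) : T := (x.1 + s x.2, ~~ x.2).
have s_neq0 c : s c != 0 by case: c; rewrite /s ?oppr_eq0 oner_eq0.
have sN c : s (~~ c) = - s c by case: c; rewrite /s ?opprK.
have gK : involutive g by case=> i c; rewrite /g /= negbK sN addrK.
have fK : involutive f by case=> i c; rewrite /f /= negbK.
have cardT : #|T| = k.*2.+4.+2.
  by rewrite card_prod card_ord card_bool muln2 !doubleS.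
(* This separates [1] from [-1], and so [(1, true)] from [g (0, false)]. *)
have n2 : (2%:R : 'I_k.+3) != 0 by rewrite natr_ord_neq0.
have [|x y|x|x|x|//|||G wG] :=
  @matching_wgraph5 T f (fun x => [:: x; f x; g x]) 3 fK _ _ _ _ _ _
    (0, false) (1, true).
- by case=> i []; rewrite /f xpair_eqE andbF.
- by rewrite !inE eq_sym (eq_sym y) (eq_sym y) (inv_eq fK) (inv_eq gK).
- by rewrite mem_head.
- by rewrite !inE eqxx orbT.
- case: x => i c; have neq : (i == i + s c) = false.
    by rewrite eq_sym -subr_eq0 addrAC subrr add0r (negPf (s_neq0 c)).
  by rewrite /= !inE !xpair_eqE neq; case: (c); rewrite andbF.
- rewrite !inE /f /g !xpair_eqE /= add0r -addr_eq0 -mulr2n.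
  by rewrite (negPf n2).
- by rewrite !inE /f /g !xpair_eqE.
by exists T, G; rewrite -{1}[k.*2.+3](addnK 3) addn3 -cardT.
Qed.

(** Gives the degrees in the cyclic constructions, where the neighbourhood of [x] is a fixed set of
    differences translated by [x]. *)
Lemma card_translate (V : finZmodType) (x : V) (S : {set V}) :
  #|[set y | y - x \in S]| = #|S|.
Proof.
rewrite -(card_imset S (addrI x)); apply: eq_card => y; rewrite inE.
apply/idP/imsetP => [Syx|[d Sd ->]]; last by rewrite addrC addKr.
by exists (y - x); rewrite // addrC subrK.
Qed.

Lemma card_seq_set (V : finType) (S : seq V) :
  uniq S -> #|[set y in S]| = size S.
Proof. by move/card_uniqP <-; apply: eq_card => y; rewrite inE. Qed.

Lemma card_seq_setC (V : finType) (S : seq V) :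
  uniq S -> #|~: [set y in S]| = (#|V| - size S)%N.
Proof. by move=> US; rewrite cardsCs setCK card_seq_set. Qed.

Lemma ord_neq n k (x y : 'I_n.+2) : x = y + k%:R -> (0 < k < n.+2)%N -> x != y.
Proof. by move=> -> /natr_ord_neq0 nk; rewrite -subr_eq0 addrC addKr. Qed.

Ltac ring_or_lia := solve [ring | lia].
(** Small integers are distinct modulo [n.+2] when their difference is positive and below the
    modulus; differences up to 5 occur. *)
Ltac ord_neq_tac := first [apply: (@ord_neq _ 1); ring_or_lia
  | apply: (@ord_neq _ 2); ring_or_lia | apply: (@ord_neq _ 3); ring_or_lia
  | apply: (@ord_neq _ 4); ring_or_lia | apply: (@ord_neq _ 5); ring_or_lia].
Ltac distinct_tac := rewrite /= ?inE ?negb_or ?andbT;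
  do ?(apply/andP; split); first [by [] | ord_neq_tac | rewrite eq_sym;
    ord_neq_tac].

(** The boolean gives the side of the bipartite graph, which rules out odd cycles; two consecutive
    light steps return to their start, which rules out light paths of length 2. *)
Lemma exists_1_6 k :
  exists (T : finType) (G : wgraph T), is_wgraph 1 k.+1 6 G /\ #|T| = k.*2.+4.
Proof.
pose T : finType := ('I_k.+2 * bool)%type.
pose l : rel T := fun x y => (y.2 != x.2) && (y.1 == x.1).
pose h : rel T := fun x y => (y.2 != x.2) && (y.1 != x.1).
have l_sym : symmetric l by move=> x y; rewrite /l !(eq_sym y.1, eq_sym y.2).
have h_sym : symmetric h by move=> x y; rewrite /h !(eq_sym y.1, eq_sym y.2).
have l_irr : irreflexive l by move=> x; rewrite /l eqxx.
have h_irr : irreflexive h by move=> x; rewrite /h eqxx.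
have lh x y : ~~ (l x y && h x y).
  by rewrite /l /h; case: (y.2 == x.2); case: (y.1 == x.1).
pose G := WGraph (light := SGraph l_sym l_irr) (heavy := SGraph h_sym h_irr) lh.
have wN x y : wedge G x y -> y.2 = ~~ x.2.
  by rewrite /wedge /= /l /h; case: x.2 y.2 => [] [].
have lfun x y z : l x y -> l y z -> x = z.
  case: x y z => [i c] [j d] [m e] /andP[/= cd /eqP->] /andP[/= de /eqP->].
  by congr pair; case: c d e cd de => [] [] [].
exists T, G; split; last by rewrite card_prod card_ord card_bool muln2 doubleS.
split=> [x|x|].
- rewrite -[RHS](cards1 (x.1, ~~ x.2)); apply: eq_card => -[j d].
  by rewrite !inE xpair_eqE andbC /= /l /=; case: d x.2 => [] [].
- transitivity #|setX [set~ x.1] [set ~~ x.2]|.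
    apply: eq_card => -[j d]; rewrite !inE /= /h /= andbC.
    by case: d x.2 => [] [].
  by rewrite cardsX cards1 muln1 cardsC1 card_ord.
- apply: girth_eq6.
  + exists [:: (0, false); (0, true); (1, false); (1, true)] => //.
    by rewrite weight_pairmap.
  + move=> x y z /light_wedge/wN xy /wN yz; apply/negP => /wN.
    by rewrite yz xy; case: x.2.
  + by move=> x y z t lxy lyz _ _; rewrite (lfun x y z) ?eqxx.
  + move=> x y z t u /light_wedge/wN xy /light_wedge/wN yz /light_wedge/wN zt.
    move=> /light_wedge/wN tu; apply/negP => /light_wedge/wN.
    by rewrite tu zt yz xy; case: x.2.
Qed.

Lemma exists_2_5 b :
  exists (T : finType) (G : wgraph T), is_wgraph 2 b 5 G /\ #|T| = (b + 5)%N.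
Proof.
pose T : finType := 'I_b.+4.+1.
pose d1 : seq 'I_b.+4.+1 := [:: 1; -1].
(* Differences at light distance at most 2. The first three come from two light steps and the last
   two form [d1], so [uniq d2] makes these groups disjoint. *)
pose d2 : seq 'I_b.+4.+1 := [:: 0; 2; -2; 1; -1].
have d1N d : (- d \in d1) = (d \in d1) by rewrite !inE !eqr_oppLR opprK orbC.
have d2N d : (- d \in d2) = (d \in d2).
  rewrite !inE !eqr_oppLR !opprK oppr0.
  by case: (d == 1); case: (d == -1); case: (d == 2); rewrite ?orbT ?orbF.
have Ud2 : uniq d2 by distinct_tac.
have Ud1 : uniq d1 by case/and4P: Ud2.
have d1d2 d : d \in d1 -> d \in d2 by rewrite !inE orbA => ->; rewrite !orbT.
pose l : rel T := fun x y => y - x \in d1.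
pose h : rel T := fun x y => y - x \notin d2.
have l_sym : symmetric l by move=> x y; rewrite /l -d1N opprB.
have h_sym : symmetric h by move=> x y; rewrite /h -d2N opprB.
have l_irr : irreflexive l.
  by move=> x; rewrite /l subrr; apply: negPf; move: Ud2;
    rewrite /= !inE !negb_or => /andP[/and4P[_ _ -> ->]].
have h_irr : irreflexive h by move=> x; rewrite /h subrr mem_head.
have lh x y : ~~ (l x y && h x y) by apply/negP => /andP[/d1d2];
  rewrite /h => ->.
pose G := WGraph (light := SGraph l_sym l_irr) (heavy := SGraph h_sym h_irr) lh.
have lP x y : l x y -> y = x + 1 \/ y = x - 1.
  by rewrite /l !inE => /orP[]/eqP <-; [left|right]; rewrite addrC subrK.
exists T, G; split; last by rewrite card_ord addnC.
split=> [x|x|].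
- rewrite -[RHS](card_seq_set Ud1) -[RHS](card_translate x).
  by apply: eq_card => y; rewrite !in_set.
- transitivity #|~: [set d in d2]|;
    last by rewrite card_seq_setC // card_ord !subSS subn0.
  by rewrite -[RHS](card_translate x); apply: eq_card => y;
    rewrite !(in_setC, in_set).
- apply: girth_eq5.
  + have ls i : l i (i + 1) by rewrite /l [i + 1]addrC addrK mem_head.
    have lw i : edge_weight G i (i + 1) = 1%N by rewrite edge_weight_light.
    pose v : 'I_b.+4.+1 := 0 + 1 + 1 + 1.
    have Uv : uniq [:: 0; 0 + 1; 0 + 1 + 1; v; v + 1] by distinct_tac.
    (* For [b = 0] the light cycle is itself a pentagon of weight 5. Otherwise three light edges are
       closed by a heavy edge of difference 3, which lies outside [d2] because 5 is below the
       modulus. *)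
    case: (posnP b) => [b0|b_gt0].
      have lv0 : l (v + 1) 0.
        rewrite /l (_ : _ - _ = 1) ?mem_head //.
        by rewrite /v; subst b; apply/val_inj.
      exists [:: 0; 0 + 1; 0 + 1 + 1; v; v + 1].
        by split=> //; rewrite /ucycle Uv /= /wedge /= !ls lv0.
      by rewrite weight_pairmap //= !lw edge_weight_light.
    have hv0 : h v 0.
      by rewrite /h (_ : 0 - _ = - 3) ?d2N; [distinct_tac | rewrite /v; ring].
    have {}Uv : uniq [:: 0; 0 + 1; 0 + 1 + 1; v].
      exact: (take_uniq 4 Uv).
    exists [:: 0; 0 + 1; 0 + 1 + 1; v].
      by split=> //; rewrite /ucycle Uv /= /wedge /= !ls hv0 orbT.
    by rewrite weight_pairmap //= !lw edge_weight_heavy.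
  + move=> x y z /lP yx /lP zy; have xz : x - z \in take 3 d2.
      rewrite !inE; case: yx zy => -> [] ->; apply/or3P;
      first [apply: Or31; apply/eqP; ring | apply: Or32; apply/eqP; ring
        | apply: Or33; apply/eqP; ring].
    rewrite /wedge /= negb_or /l /h negbK (mem_take xz) andbT.
    have := Ud2; rewrite -[d2](cat_take_drop 3) cat_uniq.
    case/and3P=> _ /hasPn no _.
    by apply/negP => /no /negP[].
  (* Opposite consecutive steps make two vertices coincide; three steps in one direction give a
     difference of 3 up to sign, which is not light. *)
  + have n3 : 3 \notin d1 by distinct_tac.
    move=> x y z t /lP Ey /lP Ez /lP Et xt; apply/orP.
    case: Ey => Ey; case: Ez => Ez;
      [| by left; rewrite Ez Ey addrK | by left; rewrite Ez Ey subrK |].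
    * case: Et => Et; last by right; rewrite Et Ez addrK.
      by move: xt n3; rewrite /= /l -d1N (_ : - (x - t) = 3) => [->|];
        last by rewrite Et Ez Ey; ring.
    * case: Et => Et; first by right; rewrite Et Ez subrK.
      by move: xt n3; rewrite /= /l (_ : x - t = 3) => [->|];
        last by rewrite Et Ez Ey; ring.
Qed.

(* The light cycle runs through (0, false), (0, true), (1, false), (1, true),
   etc., so the boolean is the parity of the position. *)
Lemma exists_2_6 b :
  exists (T : finType) (G : wgraph T),
    is_wgraph 2 b 6 G /\ #|T| = (2 * b + 6)%N.
Proof.
pose T : finType := ('I_b.+3 * bool)%type.
(* With [(i, c)] at position [2i + c], the two neighbouring positions are [(i, ~~ c)] and
   [(i + s c, ~~ c)]. *)
pose s (c : bool) : 'I_b.+3 := if c then 1 else -1.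
have sN c : s (~~ c) = - s c by case: c; rewrite /s ?opprK.
(* Between positions of equal parity, these are the differences at light distance 0 or 2. *)
pose d : seq 'I_b.+3 := [:: 0; 1; -1].
have dN m : (- m \in d) = (m \in d).
  by rewrite !inE !eqr_oppLR opprK oppr0 [(_ == -1) || _]orbC.
have Ud : uniq d by distinct_tac.
have sd c : s c \in d by case: c; rewrite /s !inE eqxx ?orbT.
have s_neq0 c : s c != 0 by case: c; rewrite /s ?oppr_eq0 oner_eq0.
have s2_neq0 c : s c + s c != 0.
  have n2 : (2 : 'I_b.+3) != 0 by distinct_tac.
  by case: c; rewrite /s -?opprD ?oppr_eq0 -mulr2n.
pose l : rel T := fun x y => (y.2 == ~~ x.2) && (y.1 - x.1 \in [:: 0; s x.2]).
pose h : rel T := fun x y => (y.2 == x.2) && (y.1 - x.1 \notin d).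
have l_sym : symmetric l.
  move=> [i c] [j e]; rewrite /l /=; case: eqP => [->|ne].
    by rewrite negbK eqxx /= !inE sN -opprB !eqr_oppLR oppr0.
  by case: eqP => // ce; case: ne; rewrite ce negbK.
have h_sym : symmetric h by move=> x y; rewrite /h eq_sym -dN opprB.
have l_irr : irreflexive l by move=> x; rewrite /l; case: x.2.
have h_irr : irreflexive h by move=> x; rewrite /h subrr mem_head andbF.
have lh x y : ~~ (l x y && h x y).
  by apply/negP => /andP[/andP[/eqP e _] /andP[]]; rewrite e; case: x.2.
pose G := WGraph (light := SGraph l_sym l_irr) (heavy := SGraph h_sym h_irr) lh.
have lP i c y : l (i, c) y -> y = (i, ~~ c) \/ y = (i + s c, ~~ c).
  case: y => j e /andP[/= /eqP->]; rewrite !inE subr_eq0.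
  by case/orP=> /eqP; [move=> ->; left | move=> <-; right; rewrite addrC subrK].
(* Light edges change the parity and heavy edges keep it, so every cycle has an even number of light
   edges. *)
have lN x y : l x y -> y.2 = ~~ x.2 by case/andP => /eqP.
have hN x y : h x y -> y.2 = x.2 by case/andP => /eqP.
have l2 x y z : l x y -> l y z -> ~~ h z x.
  case: x => i c /lP[]-> /lP[]->; rewrite /h /= ?negbK ?sN ?eqxx ?negbK.
  - by rewrite subrr mem_head.
  - by rewrite opprB addrC subrK sd.
  - by rewrite opprD addrA subrr add0r dN sd.
  - by rewrite addrK subrr mem_head.
(* Three light steps without reversal cannot be closed by a fourth, because neither [s c] nor
   [s c + s c] vanishes. *)
have l3 x y z t : l x y -> l y z -> l z t -> l t x -> (x == z) || (y == t).
  case: x => i c /lP[]-> /lP[]-> /lP[]->;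
    rewrite /l /= !negbK ?sN ?eqxx ?orbT //=.
  - rewrite opprB addrC subrK !inE (negPf (s_neq0 c)) -addr_eq0.
    by rewrite (negPf (s2_neq0 c)).
  - by rewrite subrK eqxx orbT.
  - rewrite opprD addrA opprD addrA subrr add0r !inE -opprD oppr_eq0 eqr_opp.
    by rewrite (negPf (s2_neq0 c)) -subr_eq0 addrK (negPf (s_neq0 c)).
  - by rewrite addrK eqxx.
  - by rewrite addrK eqxx.
exists T, G; split; last first.
  by rewrite card_prod card_ord card_bool; lia.
split=> [x|x|].
- transitivity
    #|setX [set j | j - x.1 \in [set m in [:: 0; s x.2]]] [set ~~ x.2]|.
    by apply: eq_card => -[j e]; rewrite in_setX in_set1 !in_set andbC.
  rewrite cardsX cards1 muln1 card_translate card_seq_set //.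
  by rewrite /= inE eq_sym s_neq0.
- transitivity #|setX [set j | j - x.1 \in ~: [set m in d]] [set x.2]|.
    by apply: eq_card => -[j e];
      rewrite in_setX in_set1 !(in_setC, in_set) andbC.
  rewrite cardsX cards1 muln1 card_translate card_seq_setC // card_ord.
  by rewrite !subSS subn0.
- apply: girth_eq6.
  + have ls0 i c : l (i, c) (i, ~~ c) by rewrite /l /= eqxx subrr mem_head.
    have ls1 i : l (i, true) (i + 1, false).
      by rewrite /l /= addrC addKr !inE eqxx orbT.
    pose v : 'I_b.+3 := 0 + 1 + 1.
    have Uv : uniq [:: 0; 0 + 1; v] by rewrite /v; distinct_tac.
    have Uc : uniq [:: (0, false); (0, true); (0 + 1, false); (0 + 1, true);
                       (v, false); (v, true)].
      apply: (@allpairs_uniq _ _ _ pair _ [:: false; true] Uv) => //.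
      by move=> [? ?] [? ?] _ _ /= [-> ->].
    (* For [b = 0] the light cycle is a hexagon of weight 6; otherwise four light edges are closed
       by a heavy edge. *)
    case: (posnP b) => [b0|b_gt0].
      have lv0 : l (v, true) (0, false).
        rewrite /l /= (_ : 0 - v = 1) ?inE ?eqxx ?orbT //.
        by rewrite /v; clear -b0; subst b; apply/val_inj.
      exists [:: (0, false); (0, true); (0 + 1, false); (0 + 1, true);
                 (v, false); (v, true)].
        by split=> //; rewrite /ucycle Uc /= /wedge /= !ls0 !ls1 lv0.
      by rewrite weight_pairmap //= !edge_weight_light.
    have hv0 : h (v, false) (0, false).
      rewrite /h /= (_ : 0 - v = - 2) ?dN; [distinct_tac | rewrite /v; ring].
    exists [:: (0, false); (0, true); (0 + 1, false); (0 + 1, true);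
      (v, false)].
      by split=> //; rewrite /ucycle (take_uniq 5 Uc) /= /wedge /= !ls0 !ls1
        hv0.
    rewrite weight_pairmap ?(take_uniq 5 Uc) //= (@edge_weight_heavy _ G _ _
      hv0).
    by rewrite !edge_weight_light.
  + move=> x y z lxy; rewrite /wedge => /orP[lyz|hyz]; rewrite negb_or.
      apply/andP; split; last exact: l2 lxy lyz.
      apply/negP => /lN.
      by rewrite (lN _ _ lyz) (lN _ _ lxy); case: x.2.
    apply/andP; split; apply/negP.
      by move=> lzx; case/negP: (l2 _ _ _ lzx lxy).
    by move=> /hN; rewrite (hN _ _ hyz) (lN _ _ lxy); case: x.2.
  + move=> x y z t lxy lyz lzt /orP[|/hN]; first exact: l3.
    by rewrite (lN _ _ lzt) (lN _ _ lyz) (lN _ _ lxy); case: x.2.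
  + move=> x y z t u lxy lyz lzt ltu; apply/negP => /lN.
    rewrite (lN _ _ ltu) (lN _ _ lzt) (lN _ _ lyz) (lN _ _ lxy).
    by case: x.2.
Qed.

End Existence.

(** * The minimum orders *)

Lemma min_order_eq a b g n :
  (exists (T : finType) (G : wgraph T), is_wgraph a b g G /\ #|T| = n) ->
  (forall (T : finType) (G : wgraph T), is_wgraph a b g G -> n <= #|T|) ->
  min_order a b g = Some n.
Proof. by move=> exG le_n; apply/min_natP;
  split=> // _ [T [G [/le_n ? <-]]]. Qed.

Theorem theorem18 (b : nat) :
  [/\ ~~ odd b -> 2 <= b -> min_order 1 b 5 = Some (b + 2),
      odd b -> 3 <= b -> min_order 1 b 5 = Some (b + 3),
      min_order 2 b 5 = Some (b + 5),
      1 <= b -> min_order 1 b 6 = Some (2 * b + 2)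
    & min_order 2 b 6 = Some (2 * b + 6)].
Proof.
split=> [b_even b2|b_odd b3||b1|].
- have [k ->] : exists k, b = k.*2.+2 by exists b.-2./2; lia.
  apply: min_order_eq => [|T G wG]; first by rewrite addn2;
    apply: exists_1_5_even.
  exact: order_ge_degree wG _.
- have [k ->] : exists k, b = k.*2.+3 by exists (b - 3)./2; lia.
  apply: min_order_eq => [|T G wG]; first by rewrite addn3;
    apply: exists_1_5_odd.
  (* For odd [b] the degree bound [b + 2] is odd, and the parity of the order adds one. *)
  by have := order_ge_degree wG isT; case: wG => /order_even; lia.
- apply: min_order_eq => [|T G wG]; first exact: exists_2_5.
  exact: order_ge_2_5 wG _.
- apply: min_order_eq => [|T G wG]; last exact: order_ge_1_6 wG _ _.
  by case: b b1 => // k _; rewrite mul2n addn2 doubleS; apply: exists_1_6.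
- apply: min_order_eq => [|T G wG]; first exact: exists_2_6.
  exact: order_ge_2_6 wG _.
Qed.
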